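(* Let $D$ be a mixed graph. If for every cycle $C$ of $D$ and every traversal $\vec C$ the difference between the number of forward arcs and the number of backward arcs encountered along $\vec C$ is even, then $\sigma_\gamma(D)=\sigma_\omega(D)$, where $\gamma=e^{2\pi i/3}$ and $\omega=e^{\pi i/3}$.
   Context: A mixed graph $D$ is obtained from a finite simple undirected graph $\Gamma(D)$ by replacing some edges by arcs: between any two adjacent vertices $u,v$ there is exactly one of a digon $u\sim v$, an arc $u\to v$, or an arc $v\to u$. Cycles refer to $\Gamma(D)$. For $|\alpha|=1$, $H^\alpha(D)=[h_{uv}]$ has $h_{uv}=1$ if $u\sim v$, $\alpha$ if $u\to v$, $\bar\alpha$ if $v\to u$, $0$ otherwise, and $\sigma_\alpha(D)$ is its multiset of eigenvalues. For a cycle with vertices $v_1,\dots,v_\ell$ in cyclic order, a traversal is the closed walk $v_1,\dots,v_\ell,v_1$ (either direction); a step with $v_i\to v_{i+1}$ is a forward arc, a step with $v_{i+1}\to v_i$ a backward arc. *)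

(* Defs.v *)
From HB Require Import structures.
From mathcomp Require Import all_boot all_order all_algebra.
From mathcomp Require Import finmap multiset.
From mathcomp Require Import reals trigo.
From mathcomp Require Import complex.

Set Implicit Arguments.
Unset Strict Implicit.
Unset Printing Implicit Defensive.

Import Order.TTheory GRing.Theory Num.Theory.
Local Open Scope mset_scope.
Local Open Scope ring_scope.

(* [mg_arcN] with u = v also rules out loops made of an arc. *)
Record mixed_graph (V : finType) := MixedGraph {
  digon : rel V;
  arc : rel V;
  mg_digon_sym : symmetric digon;
  mg_digon_irr : irreflexive digon;
  mg_arcN : forall u v, arc u v -> ~~ arc v u;
  mg_arc_digonN : forall u v, arc u v -> ~~ digon u v
}.

Section MixedGraph.
Variables (V : finType) (D : mixed_graph V).

Definition adj : rel V := fun u v => [|| digon D u v, arc D u v | arc D v u].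

(* The list v_1, ..., v_l stands for a cycle with these vertices in cyclic
   order; the edge closing it, v_l v_1, is part of [ucycleb]. *)
Definition is_cycle (c : seq V) : bool := (2 < size c)%N && ucycleb adj c.

(* A list t read as a closed walk t_1, ..., t_l, t_1. *)
Definition traversals (c : seq V) : seq (seq V) := [:: c; rev c].

Definition steps (t : seq V) : seq (V * V) := zip t (rot 1 t).

Definition nb_forward (t : seq V) : nat :=
  count (fun p => arc D p.1 p.2) (steps t).

Definition nb_backward (t : seq V) : nat :=
  count (fun p => arc D p.2 p.1) (steps t).

Definition hentry (C : numClosedFieldType) (alpha : C) (u v : V) : C :=
  if digon D u v then 1
  else if arc D u v then alpha
  else if arc D v u then alpha^*
  else 0.

Definition hmx (C : numClosedFieldType) (alpha : C) : 'M[C]_#|V| :=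
  \matrix_(i, j) hentry alpha (enum_val i) (enum_val j).

End MixedGraph.

(* Eigenvalues counted with algebraic multiplicity. *)
Definition eigenvalues (C : closedFieldType) (n : nat) (A : 'M[C]_n) :
    {mset C} :=
  seq_mset (sval (closed_field_poly_normal (char_poly A))).

Definition sigma (V : finType) (D : mixed_graph V)
    (C : numClosedFieldType) (alpha : C) : {mset C} :=
  eigenvalues (hmx D alpha).

(* e^{i t} *)
Definition expi (R : realType) (t : R) : R[i] := (cos t +i* sin t)%C.

(* Main.v *)
Require Import Defs.
From mathcomp Require Import all_boot all_order all_algebra.
From mathcomp Require Import finmap multiset.
From mathcomp Require Import reals trigo.
From mathcomp Require Import complex.
From mathcomp Require Import zify ring.

(** Since [- omega] is the conjugate of [gamma], the matrix [H^omega] is obtained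
    from the transpose of [H^gamma] by negating the entries at the arcs.  As every
    cycle carries an even number of arcs, so does every closed walk; hence the
    parity of the number of arcs on a walk from a fixed base point of each
    component is a potential, and conjugating by the corresponding diagonal
    matrix of signs performs exactly this negation. *)

Set Implicit Arguments.
Unset Strict Implicit.
Unset Printing Implicit Defensive.

Import Order.TTheory GRing.Theory Num.Theory.

Local Open Scope ring_scope.

Lemma not_uniq_split (T : eqType) (s : seq T) :
  ~~ uniq s -> exists y s1 s2 s3, s = s1 ++ y :: s2 ++ y :: s3.
Proof.
elim: s => //= x s IHs; rewrite negb_and negbK => /orP[/splitPr[s2 s3]|/IHs].
  by exists x, [::], s2, s3.
by case=> y [s1 [s2 [s3 ->]]]; exists y, (x :: s1), s2, s3.
Qed.

Section WalkParity.
Variables (T : finType) (e w : rel T).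

Definition walk_parity (x : T) (p : seq T) : bool :=
  odd (count id (pairmap w x p)).

Lemma walk_parity_cons x y p :
  walk_parity x (y :: p) = w x y (+) walk_parity y p.
Proof. by rewrite /walk_parity /= oddD oddb. Qed.

Lemma walk_parity_cat x p q :
  walk_parity x (p ++ q) = walk_parity x p (+) walk_parity (last x p) q.
Proof. by rewrite /walk_parity pairmap_cat count_cat oddD. Qed.

Hypothesis e_sym : symmetric e.
Hypothesis e_irr : irreflexive e.
Hypothesis w_sym : symmetric w.
Hypothesis cycle_even : forall x p,
  (1 < size p)%N -> uniq (x :: p) -> cycle e (x :: p) ->
  walk_parity x (rcons p x) = false.

(* A closed walk that repeats a vertex splits there into two shorter ones. *)
Lemma closed_walk_even x p :
  path e x p -> last x p = x -> walk_parity x p = false.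
Proof.
have [n] := ubnP (size p); elim: n x p => // n IHn x p /ltnSE szp ep lastp.
(* Because the walk ends at [x], repetitions are sought in [p] alone; counting the start as well
   would always repeat [x]. *)
have [Up|/not_uniq_split[y [p1 [p2 [p3 Dp]]]]] := boolP (uniq p); last first.
  move: szp ep lastp; rewrite {}Dp size_cat /= size_cat /= => szp.
  rewrite cat_path /= cat_path /= !last_cat /= last_cat /=.
  case/and5P=> ep1 ep1y ep2 ep2y ep3 lastp.
  have loop : walk_parity y (rcons p2 y) = false.
    apply: IHn; last by rewrite last_rcons.
      by rewrite size_rcons; lia.
    by rewrite rcons_path ep2.
  have rest : walk_parity x (p1 ++ y :: p3) = false.
    apply: IHn; last by rewrite last_cat.
      by rewrite size_cat /=; lia.
    by rewrite cat_path /= ep1 ep1y ep3.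
  rewrite walk_parity_cat walk_parity_cons in rest.
  by rewrite walk_parity_cat walk_parity_cons -cat_rcons walk_parity_cat loop
             last_rcons.
case/lastP: p => [//|q z] in szp ep lastp Up *.
move: lastp; rewrite last_rcons => zx; rewrite {}zx {z} in szp ep Up *.
(* By length: a single step would be a loop; two steps run over one edge and back, so its weight
   cancels; three or more form a cycle. *)
case: q => [|y [|z q]] in szp ep Up *.
- by move: ep; rewrite /= e_irr.
- by rewrite /= !walk_parity_cons w_sym addbF addbb.
- by apply: cycle_even => //; rewrite rcons_uniq in Up.
Qed.

Lemma switching_exists :
  exists s : T -> bool, forall u v, e u v -> s u (+) s v = w u v.
Proof.
have e_csym := sym_connect_sym e_sym.
have walkP u :
    exists p, path e (fingraph.root e u) p && (last (fingraph.root e u) p == u).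
  have /connectP[p ep Dp] : connect e (fingraph.root e u) u.
    by rewrite e_csym connect_root.
  by exists p; rewrite ep -Dp eqxx.
exists (fun u => walk_parity (fingraph.root e u) (xchoose (walkP u))) => u v euv.
(* One walk [b] from [v] back to the root closes both the chosen walk to [v] and the chosen walk to
   [u] followed by the edge [u v]. Both closed walks are even, and adding their parities cancels
   [b]. *)
have /connectP[b eb Db] := connect_root e v.
have r_uv : fingraph.root e v = fingraph.root e u.
  by apply/esym/eqP; rewrite root_connect ?connect1.
have /andP[] := xchooseP (walkP u); have /andP[] := xchooseP (walkP v).
move: (xchoose (walkP v)) (xchoose (walkP u)) => p q.
rewrite {}r_uv in Db * => ep /eqP Dp eq /eqP Dq.
have := @closed_walk_even (fingraph.root e u) (p ++ b).
rewrite cat_path last_cat Dp ep eb walk_parity_cat Dp => /(_ isT (esym Db)).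
have := @closed_walk_even (fingraph.root e u) (q ++ v :: b).
rewrite cat_path last_cat /= Dq eq euv eb => /(_ isT (esym Db)).
rewrite walk_parity_cat Dq walk_parity_cons.
by do 3!case: (walk_parity _ _); case: (w u v).
Qed.

End WalkParity.

Lemma pairmap_zip (T S : Type) (f : T -> T -> S) x y q :
  pairmap f x (rcons q y) = [seq f p.1 p.2 | p <- zip (x :: q) (rcons q y)].
Proof. by elim: q x => //= z q IHq x; rewrite IHq. Qed.

Section MixedGraphSwitching.
Variables (V : finType) (D : mixed_graph V).

Definition is_arc : rel V := fun u v => Defs.arc D u v || Defs.arc D v u.

Lemma arc_irr : irreflexive (Defs.arc D).
Proof. by move=> u; apply/negP => auu; move: (mg_arcN auu); rewrite auu. Qed.

Lemma adj_sym : symmetric (adj D).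
Proof. by move=> u v; rewrite /adj mg_digon_sym; congr orb; exact: orbC. Qed.

Lemma adj_irr : irreflexive (adj D).
Proof. by move=> u; rewrite /adj mg_digon_irr arc_irr. Qed.

Lemma nb_arcs x q :
  (nb_forward D (x :: q) + nb_backward D (x :: q))%N =
  count id (pairmap is_arc x (rcons q x)).
Proof.
rewrite /nb_forward /nb_backward /steps rot1_cons pairmap_zip count_map.
(* Inclusion-exclusion: no step is an arc in both directions, so the intersection counts nothing. *)
rewrite -count_predUI [X in (_ + X)%N](eq_count (a2 := pred0)) ?count_pred0.
  by rewrite addn0.
by move=> [u v] /=; apply/negP => /andP[/mg_arcN/negP].
Qed.

Hypothesis cycles_even : forall c, is_cycle D c -> forall t, t \in traversals c ->
  (2 %| (nb_forward D t)%:Z - (nb_backward D t)%:Z)%Z.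

Lemma arc_switching :
  exists s : V -> bool, forall u v, adj D u v -> s u (+) s v = is_arc u v.
Proof.
apply: switching_exists; [exact: adj_sym | exact: adj_irr | |].
  by move=> u v; exact: orbC.
move=> x p szp Up ep.
have /cycles_even/(_ (x :: p)) : is_cycle D (x :: p).
  by apply/and3P; split.
rewrite mem_head => /(_ isT).
rewrite /walk_parity -nb_arcs.
(* The difference [f - b] and the total number of arcs [f + b] have the same parity. *)
by set f := nb_forward _ _; set b := nb_backward _ _; lia.
Qed.

End MixedGraphSwitching.

(** With [S] the diagonal matrix of the signs, [A] is [S *m B^T *m S] and [S] is its own inverse;
    similarity and transposition preserve the characteristic polynomial. *)
Lemma char_poly_sign_trmx (R : comNzRingType) (n : nat) (A B : 'M[R]_n)
    (s : 'I_n -> bool) :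
  (forall i j, A i j = (-1) ^+ (s i (+) s j) * B j i) -> char_poly A = char_poly B.
Proof.
move=> DA; pose S : 'M[{poly R}]_n := diag_mx (\row_i (-1) ^+ s i).
have SS : S *m S = 1%:M.
  rewrite mulmx_diag -diag_const_mx; congr diag_mx.
  by apply/rowP=> i; rewrite !mxE -signr_addb addbb.
have -> : char_poly A = \det (S *m (char_poly_mx B)^T *m S).
  congr (\det _); apply/matrixP => i j.
  rewrite mul_mx_diag mul_diag_mx !mxE DA rmorphM rmorph_sign /= [j == i]eq_sym.
  rewrite mulrAC -signr_addb mulrBr; congr (_ - _).
  (* The term ['X] lives on the diagonal only, where the two signs cancel. *)
  by case: eqP => [->|_]; rewrite ?addbb ?mul1r ?mulr0n ?mulr0.
by rewrite !det_mulmx mulrAC -det_mulmx SS det1 mul1r det_tr.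
Qed.

(** Transposing reverses arcs, hence conjugates their entries, and the conjugate of [a] is [- b];
    digon and zero entries are symmetric and keep their value. *)
Lemma hentry_switch (V : finType) (D : mixed_graph V) (C : numClosedFieldType)
    (a b : C) u v :
  - b = a^* -> hentry D b u v = (-1) ^+ is_arc D u v * hentry D a v u.
Proof.
move=> Db; have -> : b = - a^* by rewrite -Db opprK.
rewrite /hentry /is_arc [digon D v u]mg_digon_sym.
have [duv|_] := boolP (digon D u v).
  have auv : Defs.arc D u v = false by apply: contraTF duv => /mg_arc_digonN.
  have avu : Defs.arc D v u = false.
    by rewrite mg_digon_sym in duv; apply: contraTF duv => /mg_arc_digonN.
  by rewrite auv avu mul1r.
have [auv|_] := boolP (Defs.arc D u v).
  by rewrite (negPf (mg_arcN auv)) /= mulN1r.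
by case: (Defs.arc D v u); rewrite /= ?mulr0 // mulN1r rmorphN /= conjCK.
Qed.

Lemma hentry_nadj (V : finType) (D : mixed_graph V) (C : numClosedFieldType)
    (a : C) u v :
  ~~ adj D u v -> hentry D a u v = 0.
Proof. by rewrite /hentry /adj !negb_or => /and3P[/negPf-> /negPf-> /negPf->]. Qed.

Lemma opp_expi_pi3 (R : realType) :
  - expi (pi / 3 : R) = (expi (2 * pi / 3 : R))^*.
Proof.
(* Adding [pi] negates cosine and sine, while the reflected angle matches the conjugation. *)
have -> : 2 * pi / 3 = - (pi / 3) + pi :> R by field.
by rewrite /expi cosDpi sinDpi cosN sinN opprK.
Qed.

Theorem theorem4p8 (R : realType) (V : finType) (D : mixed_graph V) :
  (forall c : seq V, is_cycle D c ->
     forall t : seq V, t \in traversals c ->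
       (2 %| (nb_forward D t)%:Z - (nb_backward D t)%:Z)%Z) ->
  sigma D (expi (2 * pi / 3 : R)) = sigma D (expi (pi / 3 : R)).
Proof.
move=> /arc_switching[s sP]; rewrite /sigma /eigenvalues.
(* The multiset of eigenvalues is a function of the characteristic polynomial. *)
suff -> : char_poly (hmx D (expi (pi / 3 : R))) =
          char_poly (hmx D (expi (2 * pi / 3 : R))) by [].
apply: (char_poly_sign_trmx (s := s \o enum_val)) => i j; rewrite !mxE /=.
move: (enum_val i) (enum_val j) => u v.
(* The switching [s] is controlled only along edges; elsewhere both entries vanish, whatever the
   sign. *)
have [uv|nuv] := boolP (adj D u v); last first.
  by rewrite !hentry_nadj ?mulr0 // adj_sym.
by rewrite sP //; apply/hentry_switch/opp_expi_pi3.
Qed.
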